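(* Let $u\in C^4(\mathbb{R}^n)$ be convex with $\tilde K^M_u\equiv 0$ on $\mathbb{R}^n$. Assume that the graph $M_u$ of $u$ admits no timelike points and that $$\lim_{x\to\infty}\tilde H^M_u(x)=0.$$ Then $M_u$ is a hyperplane.
   Context: The setting is the Minkowski space $\mathbb{R}^{n,1}$, i.e. $\mathbb{R}^n\times\mathbb{R}$ with the metric $dx_1^2+\cdots+dx_n^2-dx_{n+1}^2$. For $u:\mathbb{R}^n\to\mathbb{R}$, $M_u=\{(x,u(x)):x\in\mathbb{R}^n\}$ is its graph. A point $x\in\mathbb{R}^n$ is called a spacelike (resp. lightlike, timelike) point of $M_u$ if $\|Du(x)\|<1$ (resp. $\|Du(x)\|=1$, $\|Du(x)\|>1$), where $\|\cdot\|$ is the Euclidean norm on $\mathbb{R}^n$. Subscripts denote partial derivatives and repeated indices are summed from $1$ to $n$. With $w^M=1-\|Du\|^2$, define $$\tilde H^M_u=w^M\,\Delta u+u_iu_ju_{ij},\qquad \tilde K^M_u=\det D^2u .$$ (At spacelike points these are the mean and Gaussian curvatures of $M_u$ multiplied by $(w^M)^{3/2}$ and $(w^M)^{(n+2)/2}$, respectively.) The limit $x\to\infty$ means $\|x\|\to\infty$ in $\mathbb{R}^n$. *)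

(* Defs.v *)
From HB Require Import structures.
From mathcomp Require Import all_boot all_order all_algebra.
From mathcomp Require Import all_classical all_reals all_analysis.
Set Implicit Arguments.
Unset Strict Implicit.
Unset Printing Implicit Defensive.
Import Order.TTheory GRing.Theory Num.Theory.
Import numFieldNormedType.Exports.
Local Open Scope classical_set_scope.
Local Open Scope ring_scope.

(* The norm that ['rV[R]_n] carries in the library is the sup norm. It induces
   the usual topology, but the causal character of a point depends on the
   Euclidean norm, hence [enorm]. *)
Definition dotv (R : realType) (n : nat) (x y : 'rV[R]_n) : R :=
  \sum_i x 0 i * y 0 i.

Definition enorm (R : realType) (n : nat) (x : 'rV[R]_n) : R :=
  Num.sqrt (dotv x x).

Definition at_infty (R : realType) (n : nat) : set_system 'rV[R]_n :=
  filter_from [set: R] (fun M => [set x | M < enorm x]).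

Arguments at_infty {R n}.

#[global] Instance at_infty_filter (R : realType) (n : nat) :
  Filter (@at_infty R n).
Proof.
apply: filter_from_filter; first by exists 0.
move=> a b _ _; exists (Num.max a b) => // x /=.
by rewrite gt_max => /andP[].
Qed.

Definition partial (R : realType) (n : nat) (i : 'I_n) (f : 'rV[R]_n -> R) :
  'rV[R]_n -> R := fun x => 'D_(delta_mx 0 i) f x.

(* All iterated partial derivatives of order at most [k] exist and are
   continuous everywhere. Existence is demanded separately because ['D_v f] is
   a total operator. *)
Fixpoint class_C (R : realType) (n k : nat) (f : 'rV[R]_n -> R) : Prop :=
  continuous f /\
  if k is k'.+1 then
    forall i : 'I_n,
      (forall x, derivable f x (delta_mx 0 i)) /\ class_C k' (partial i f)
  else True.

Definition grad (R : realType) (n : nat) (u : 'rV[R]_n -> R) (x : 'rV[R]_n) :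
  'rV[R]_n := \row_i partial i u x.

Definition hessian (R : realType) (n : nat) (u : 'rV[R]_n -> R)
  (x : 'rV[R]_n) : 'M[R]_n := \matrix_(i, j) partial j (partial i u) x.

Definition laplacian (R : realType) (n : nat) (u : 'rV[R]_n -> R)
  (x : 'rV[R]_n) : R := \sum_i partial i (partial i u) x.

Definition timelike (R : realType) (n : nat) (u : 'rV[R]_n -> R)
  (x : 'rV[R]_n) : Prop := 1 < enorm (grad u x).

Definition wM (R : realType) (n : nat) (u : 'rV[R]_n -> R) (x : 'rV[R]_n) : R :=
  1 - enorm (grad u x) ^+ 2.

Definition tildeHM (R : realType) (n : nat) (u : 'rV[R]_n -> R)
    (x : 'rV[R]_n) : R :=
  wM u x * laplacian u x +
  \sum_i \sum_j partial i u x * partial j u x * partial j (partial i u) x.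

Definition tildeKM (R : realType) (n : nat) (u : 'rV[R]_n -> R)
  (x : 'rV[R]_n) : R := \det (hessian u x).

Definition graph_of (R : realType) (n : nat) (u : 'rV[R]_n -> R) :
  set ('rV[R]_n * R) := [set p | p.2 = u p.1].

(* The Lorentzian metric plays no role in being a hyperplane: these are the
   level sets of the nonzero linear forms on R^n x R. *)
Definition hyperplane (R : realType) (n : nat) (A : set ('rV[R]_n * R)) : Prop :=
  exists (a : 'rV[R]_n) (b c : R),
    (a != 0 \/ b != 0) /\ A = [set p | dotv a p.1 + b * p.2 = c].

(* Main.v *)
(* If the gradients of [u] do not lie in a hyperplane, then n + 1 of them span a
   simplex, and [u] minus a linear form with slope in its interior is coercive;
   subtracting a small multiple of |x|^2 leaves an interior local minimum, at
   which the Hessian is positive definite, against [tildeKM u = 0]. Hence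
   <Du, v> is constant for some v <> 0, so tildeHM is invariant along v and its
   limit at infinity forces it to vanish identically. Both of its terms being
   nonnegative, <Du, D^2u Du> = 0, hence D^2u Du = 0.

   Then Du is constant on each forward ray x + t Du(x), because
   |Du(x + t p) - p|^2, with p = Du(x), is nonincreasing along it. Every x is
   y + tau Du(y) for a minimiser y of u(z) + |z - x|^2 / (2 tau), so the backward
   rays have the same property. Letting tau tend to infinity in the gradient
   inequality along a backward ray gives |Du(x)|^2 <= <Du(z), Du(x)> for all x
   and z; by symmetry |Du(x) - Du(z)|^2 <= 0. *)
Require Import Defs.
From mathcomp Require Import all_boot all_order all_algebra ring lra.
From mathcomp Require Import all_classical all_reals all_analysis.
Import Order.TTheory GRing.Theory Num.Theory.
Import numFieldNormedType.Exports.
Local Open Scope classical_set_scope.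
Local Open Scope ring_scope.
Set Implicit Arguments.
Unset Strict Implicit.
Unset Printing Implicit Defensive.

(** * Directional derivatives and the mean value theorem along a line *)

Section Directional.
Context {R : realType} {V : normedModType R}.
Implicit Types (x v w : V) (f F G : V -> R).

Lemma is_derive_lineP x v f (s l : R) :
  is_derive (x + s *: v) v f l <->
  is_derive s (1 : R) (fun t : R => f (x + t *: v)) l.
Proof.
have E : (fun h : R => h^-1 *: (((fun t : R => f (x + t *: v)) \o shift s)
              (h *: (1 : R)) - f (x + s *: v))) =
         (fun h : R => h^-1 *: ((f \o shift (x + s *: v)) (h *: v)
              - f (x + s *: v))).
  apply/funext => h /=; congr (_ *: (f _ - _)).
  by rewrite [h *: 1]mulr1 scalerDl addrCA.
split=> -[dv <-]; split; first by rewrite /derivable E.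
- by rewrite /derive E.
- by rewrite /derivable -E.
- by rewrite /derive -E.
Qed.

Lemma is_derive_cvgP x v f (l : R) :
  is_derive x v f l <->
  (fun h : R => h^-1 *: ((f \o shift x) (h *: v) - f x)) @ 0^' --> l.
Proof.
split=> [[dv <-] //|H].
by split; [exact: cvgP H|exact: (cvg_lim _ H)].
Qed.

Lemma is_derive_dirZ x v f (a l : R) :
  is_derive x v f l -> is_derive x (a *: v) f (a * l).
Proof.
move=> d; rewrite -[x]addr0 -[X in x + X](scale0r (a *: v)).
apply/is_derive_lineP.
have -> : (fun t : R => f (x + t *: (a *: v))) =
          (fun t => f (x + t *: v)) \o ( *%R^~ a).
  by apply/funext => t /=; rewrite scalerA.
rewrite mulrC; apply: is_derive1_comp.
  by rewrite mul0r; apply/is_derive_lineP; rewrite scale0r addr0.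
have -> : *%R^~ a = a \*: (@id R) by apply/funext => t /=; exact: mulrC.
by rewrite -[X in is_derive _ _ _ X]mulr1; apply: is_deriveZ.
Qed.

(** The segment is parametrised over [[0, 1]] with direction [h *: v], so that no case split on the
    sign of [h] arises. *)
Lemma line_MVT x v f F (h : R) :
  (forall y, is_derive y v f (F y)) ->
  exists2 t : R, `|t| <= `|h| & f (x + h *: v) - f x = h * F (x + t *: v).
Proof.
move=> df; pose g (t : R) := f (x + t *: (h *: v)).
have dg (t : R) : is_derive t (1 : R) g (h * F (x + t *: (h *: v))).
  by apply/is_derive_lineP; apply: is_derive_dirZ.
have cg : {within `[0, 1], continuous g}.
  by apply: derivable_within_continuous => t _; have := dg t; case.
have [t] := MVT ltr01 (fun t _ => dg t) cg.
rewrite in_itv/= => /andP[t0 t1]; rewrite subr0 mulr1 /g scale1r scale0r addr0.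
rewrite scalerA => ->; exists (t * h) => //.
by rewrite normrM ler_piMl// ger0_norm; exact: ltW.
Qed.

Lemma continuous_eps_delta G x (e : R) : continuous G -> 0 < e ->
  exists2 d : R, 0 < d & forall y, `|y| < d -> `|G x - G (x + y)| < e.
Proof.
move=> cG e0; have /cvgrPdist_lt/(_ _ e0)/nbhs_normP[d /= d0 H] := cG x.
exists d => // y yd; apply: H => /=.
by rewrite -normrN opprB addrAC subrr add0r.
Qed.

(** The increment is split into a step along [v] from [x] and a step along [w] from [x + h *: v]. By
    the mean value theorem the second quotient is a value of [G] near [x], and continuity of [G]
    gives its limit. *)
Lemma is_derive_dirD v w f F G : continuous G ->
  (forall x, is_derive x v f (F x)) -> (forall x, is_derive x w f (G x)) ->
  forall x, is_derive x (v + w) f (F x + G x).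
Proof.
move=> cG dv dw x.
have /is_derive_cvgP cl := dv x.
apply/is_derive_cvgP.
have -> : (fun h : R => h^-1 *: ((f \o shift x) (h *: (v + w)) - f x)) =
   (fun h : R => h^-1 *: ((f \o shift x) (h *: v) - f x)) \+
   (fun h : R => h^-1 *: (f (x + h *: v + h *: w) - f (x + h *: v))).
  apply/funext => h /=; rewrite -scalerDr; congr (_ *: _).
  by rewrite scalerDr [h *: v + x]addrC [_ + x]addrC addrA; ring.
apply: cvgD => //; apply/cvgrPdist_lt => e e0.
have [d d0 H] := continuous_eps_delta x cG e0.
(* The intermediate point differs from [x] by [h *: v + t *: w] with [|t| <= |h|], hence by at most
   [|h| * N]; the summand 1 keeps [N] positive. *)
pose N := `|v| + `|w| + 1.
have N0 : 0 < N by rewrite ltr_wpDl// addr_ge0.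
apply/nbhs_ballP; exists (d / N); first by rewrite /= divr_gt0.
move=> h /=; rewrite /ball/= sub0r normrN ltr_pdivlMr// => hd h0.
have [t th ->] := line_MVT (x + h *: v) h dw.
rewrite -[_ *: _]/(_ * _) mulKf// -addrA; apply: H.
apply: le_lt_trans hd; rewrite (le_trans (ler_normD _ _))// !normrZ /N.
have := ler_wpM2r (normr_ge0 w) th; have := normr_ge0 h; nra.
Qed.

End Directional.

(** * Symmetry of mixed second derivatives *)

Section SecondOrder.
Context {R : realType} {V : normedModType R}.
Implicit Types (x v w : V) (f : V -> R).

Lemma is_derive_translate x v f (c : V) (l : R) :
  is_derive (x + c) v f l -> is_derive x v (fun y => f (y + c)) l.
Proof.
move=> /is_derive_cvgP H; apply/is_derive_cvgP.
by under eq_fun do rewrite /= -addrA.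
Qed.

(** Schwarz's theorem: the second difference of [f] over a small parallelogram is [h ^+ 2] times a
    nearby value of [Fvw], and also of [Fwv]. If these differed at [x], continuity within half the
    gap would be contradicted. *)
Lemma mixed_derive_eq v w f (Fv Fw Fvw Fwv : V -> R) :
  (forall x, is_derive x v f (Fv x)) -> (forall x, is_derive x w f (Fw x)) ->
  (forall x, is_derive x w Fv (Fvw x)) -> (forall x, is_derive x v Fw (Fwv x)) ->
  continuous Fvw -> continuous Fwv -> Fvw =1 Fwv.
Proof.
move=> dv dw dvw dwv cvw cwv x.
apply/eqP; rewrite -subr_eq0 -normr_eq0; apply/negPn/negP => N.
have e0 : 0 < `|Fvw x - Fwv x| / 2.
  by rewrite divr_gt0// lt_neqAle eq_sym N normr_ge0.
have [d1 d10 H1] := continuous_eps_delta x cvw e0.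
have [d2 d20 H2] := continuous_eps_delta x cwv e0.
pose M := `|v| + `|w| + 1.
have M0 : 0 < M by rewrite ltr_wpDl// addr_ge0.
pose h := Num.min d1 d2 / (2 * M).
have m0 : 0 < Num.min d1 d2 by rewrite lt_min d10.
have h0 : 0 < h by rewrite divr_gt0// mulr_gt0.
have small (s t : R) : `|s| <= `|h| -> `|t| <= `|h| ->
    `|s *: v + t *: w| < Num.min d1 d2.
  rewrite (gtr0_norm h0) => sh th; rewrite (le_lt_trans (ler_normD _ _))// !normrZ.
  have hM : h * M < Num.min d1 d2.
    rewrite /h invfM mulrA mulrVK ?unitfE ?gt_eqF//.
    by rewrite ltr_pdivrMr// ltr_pMr// ltr1n.
  apply: le_lt_trans hM; rewrite /M.
  have := ler_wpM2r (normr_ge0 w) th; have := ler_wpM2r (normr_ge0 v) sh; nra.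
(* The mean value theorem is applied first to the increment [k] of [g] along [h *: b], then to
   [Ga]. *)
have second a b g (Ga Gab : V -> R) :
    (forall y, is_derive y a g (Ga y)) -> (forall y, is_derive y b Ga (Gab y)) ->
    exists s t : R, [/\ `|s| <= `|h|, `|t| <= `|h| &
      g (x + h *: a + h *: b) - g (x + h *: a) - (g (x + h *: b) - g x) =
      h * (h * Gab (x + s *: a + t *: b))].
  move=> da db; pose k y := g (y + h *: b) - g y.
  have dk y : is_derive y a k (Ga (y + h *: b) - Ga y).
    by apply: is_deriveB; exact: is_derive_translate.
  have [s sh] := line_MVT x h dk; rewrite /k => ->.
  have [t th ->] := line_MVT (x + s *: a) h db.
  by exists s, t.
have [s [t [sh th E1]]] := second v w f Fv Fvw dv dvw.
have [s' [t' [sh' th' E2]]] := second w v f Fw Fwv dw dwv.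
have E : Fvw (x + (s *: v + t *: w)) = Fwv (x + (t' *: v + s' *: w)).
  apply: (mulfI (lt0r_neq0 h0)); apply: (mulfI (lt0r_neq0 h0)).
  rewrite addrA -E1 [t' *: v + _]addrC addrA -E2.
  rewrite [x + h *: w + h *: v]addrAC; ring.
have /H1 B1 : `|s *: v + t *: w| < d1.
  by have := small _ _ sh th; rewrite lt_min => /andP[].
have /H2 B2 : `|t' *: v + s' *: w| < d2.
  by have := small _ _ th' sh'; rewrite lt_min => /andP[].
suff : `|Fvw x - Fwv x| < `|Fvw x - Fwv x| by rewrite ltxx.
rewrite [X in _ < X]splitr (le_lt_trans _ (ltrD B1 B2))//.
rewrite [X in _ <= _ + X]distrC E (le_trans _ (ler_normD _ _))//.
by rewrite addrA subrK.
Qed.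

End SecondOrder.

(** * Derivative tests at a local minimum on the line *)

Section LocalMin.
Context {R : realType}.
Implicit Types (f g : R -> R).

Lemma local_min_derive0 f (l : R) : (forall t, derivable f t 1) ->
  (\forall t \near 0, f 0 <= f t) -> is_derive (0 : R) (1 : R) f l -> l = 0.
Proof.
move=> df /nbhs_normP[d /= d0 H] dl.
have Nd : - d < d by rewrite (lt_trans _ d0)// oppr_lt0.
have [_ <-] := dl; suff [_ ->] : is_derive (0 : R) (1 : R) f 0 by [].
apply: (@derive1_at_min _ f (- d) d 0 (ltW Nd)) => //.
  by rewrite in_itv/= oppr_lt0 d0.
by move=> t; rewrite in_itv/= -ltr_norml => td; apply: H; rewrite /= sub0r normrN.
Qed.

(** Were [a] negative, [g] would be negative just to the right of its zero at 0, and by the mean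
    value theorem [f] would drop below [f 0] there. *)
Lemma local_min_derive2_ge0 f g (a : R) :
  (forall t : R, is_derive t (1 : R) f (g t)) -> is_derive (0 : R) (1 : R) g a ->
  (\forall t \near 0, f 0 <= f t) -> 0 <= a.
Proof.
move=> df dg mf.
have g0 : g 0 = 0.
  have dvf t : derivable f t 1 by case: (df t).
  exact: local_min_derive0 dvf mf (df 0).
rewrite leNgt; apply/negP => a0.
move: mf => /nbhs_normP[d /= d0 H].
have /is_derive_cvgP/cvgrPdist_lt := dg.
have a0' : 0 < - a by rewrite oppr_gt0.
move=> /(_ _ a0') /nbhs_normP[d' /= d'0 H'].
pose h := Num.min d d' / 2.
have m0 : 0 < Num.min d d' by rewrite lt_min d0.
have h0 : 0 < h by rewrite divr_gt0.
have hm : h < Num.min d d' by rewrite /h ltr_pdivrMr// ltr_pMr// ltr1n.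
move: hm; rewrite lt_min => /andP[hd hd'].
have cf : {within `[0, h], continuous f}.
  by apply: derivable_within_continuous => t _; have [] := df t.
have [c] := MVT h0 (fun t _ => df t) cf.
rewrite in_itv/= => /andP[c0 ch] E.
have : f 0 <= f h by apply: H; rewrite /= sub0r normrN gtr0_norm.
rewrite -subr_ge0 E subr0 pmulr_lge0// => gc.
have := H' c; rewrite /= sub0r normrN gtr0_norm// (lt_trans ch hd') gt_eqF//.
move=> /(_ isT isT); rewrite g0 subr0 addr0 [c *: 1]mulr1 -[_ *: _]/(_ * _).
have : 0 <= c^-1 * g c by rewrite mulr_ge0// invr_ge0 ltW.
by rewrite ltr_norml => ? /andP[]; lra.
Qed.

End LocalMin.

(** * The Euclidean product, the sup norm, and local minima on row vectors *)

Section RowVectors.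
Context {R : realType} {n : nat}.
Implicit Types (p x y z v w : 'rV[R]_n).

Lemma dotvC x y : dotv x y = dotv y x.
Proof. by apply: eq_bigr => i _; rewrite mulrC. Qed.

Lemma dotvDr x y z : dotv x (y + z) = dotv x y + dotv x z.
Proof. by rewrite -big_split; apply: eq_bigr => i _; rewrite mxE mulrDr. Qed.

Lemma dotvZr (a : R) x y : dotv x (a *: y) = a * dotv x y.
Proof. by rewrite mulr_sumr; apply: eq_bigr => i _; rewrite mxE mulrCA. Qed.

Lemma dotvNr x y : dotv x (- y) = - dotv x y.
Proof. by rewrite -scaleN1r dotvZr mulN1r. Qed.

Lemma dotvBr x y z : dotv x (y - z) = dotv x y - dotv x z.
Proof. by rewrite dotvDr dotvNr. Qed.

Lemma dotvBl x y z : dotv (x - y) z = dotv x z - dotv y z.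
Proof. by rewrite dotvC dotvBr !(dotvC z). Qed.

Lemma dotvDl x y z : dotv (x + y) z = dotv x z + dotv y z.
Proof. by rewrite dotvC dotvDr !(dotvC z). Qed.

Lemma dotvZl (a : R) x y : dotv (a *: x) y = a * dotv x y.
Proof. by rewrite dotvC dotvZr dotvC. Qed.

Lemma dotv_ge0 x : 0 <= dotv x x.
Proof. by apply: sumr_ge0 => i _; rewrite -expr2 sqr_ge0. Qed.

Lemma dotv_eq0 x : (dotv x x == 0) = (x == 0).
Proof.
apply/idP/eqP => [|->]; last first.
  by rewrite /dotv big1// => i _; rewrite mxE mul0r.
rewrite psumr_eq0 => [/allP H|i _]; last by rewrite -expr2 sqr_ge0.
apply/rowP => i; have := H i (mem_index_enum _).
by rewrite mxE mulf_eq0 orbb => /eqP.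
Qed.

Lemma dotv_mulmx x v (A : 'M[R]_n) : dotv (x *m A) v = dotv x (v *m A^T).
Proof.
rewrite /dotv.
under eq_bigr => i _ do rewrite mxE mulr_suml.
under [RHS]eq_bigr => i _ do rewrite mxE mulr_sumr.
rewrite exchange_big; apply: eq_bigr => i _; apply: eq_bigr => j _.
by rewrite mxE mulrAC mulrA.
Qed.

Lemma dotv_delta x (i : 'I_n) : dotv x (delta_mx 0 i) = x 0 i.
Proof.
rewrite /dotv (bigD1 i)//= mxE !eqxx mulr1 big1 ?addr0// => j ji.
by rewrite mxE (negbTE ji) andbF mulr0.
Qed.

Lemma coord_le_norm x i : `|x 0 i| <= `|x|.
Proof.
rewrite [leRHS]/Num.norm /= mx_normrE; apply/bigmax_geP; right => /=.
by exists (0, i).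
Qed.

Lemma norm_le_sum_coord x : `|x| <= \sum_i `|x 0 i|.
Proof.
have [->|x0] := eqVneq x 0; first by rewrite normr0 sumr_ge0.
have [[i j] /= e] : exists i, mx_norm x = `|x i.1 i.2|.
  by apply: mx_norm_neq0; apply: contra_neq x0; exact: mx_norm_eq0.
rewrite [leLHS]/Num.norm /= e (ord1 i) (bigD1 j)//= lerDl.
by apply: sumr_ge0.
Qed.

(** Here [|x|] is the sup norm; this bound and the next pass between it, which governs the topology,
    and the Euclidean one. *)
Lemma norm_sqr_le_dotv x : `|x| ^+ 2 <= dotv x x.
Proof.
have [->|x0] := eqVneq x 0; first by rewrite normr0 expr0n/= dotv_ge0.
have [[i j] /= e] : exists i, mx_norm x = `|x i.1 i.2|.
  by apply: mx_norm_neq0; apply: contra_neq x0; exact: mx_norm_eq0.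
rewrite [`|x|]/Num.norm /= e (ord1 i) real_normK ?num_real//.
rewrite /dotv (bigD1 j)//= -expr2 lerDl.
by apply: sumr_ge0 => k _; rewrite -expr2 sqr_ge0.
Qed.

Lemma dotv_le_norm_sqr x : dotv x x <= n%:R * `|x| ^+ 2.
Proof.
rewrite -[n in n%:R]card_ord -sumr_const mulr_suml; apply: ler_sum => i _.
by rewrite mul1r -expr2 -real_normK ?num_real// lerXn2r ?nnegrE// coord_le_norm.
Qed.

Lemma ler_norm_dotv p z : `|dotv p z| <= (\sum_i `|p 0 i|) * `|z|.
Proof.
rewrite (le_trans (ler_norm_sum _ _ _))// mulr_suml; apply: ler_sum => i _.
by rewrite normrM ler_wpM2l// coord_le_norm.
Qed.

Lemma continuous_sum_ord (F : 'I_n -> 'rV[R]_n -> R) :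
  (forall i, continuous (F i)) -> continuous (fun x => \sum_i F i x).
Proof. by move=> cF; apply: continuous_big => //; exact: add_continuous. Qed.

Lemma dotv_continuous p : continuous (dotv p).
Proof.
apply: continuous_sum_ord => i x.
exact: cvgMl_tmp (@coord_continuous R 1 n 0 i x).
Qed.

Lemma dotv_sqr_continuous : continuous (fun x => dotv x x).
Proof.
apply: continuous_sum_ord => i x.
exact: cvgM (@coord_continuous R 1 n 0 i x) (@coord_continuous R 1 n 0 i x).
Qed.

Lemma is_derive_dotv p x v : is_derive x v (dotv p) (dotv p v).
Proof.
apply/is_derive_cvgP; apply: cvg_near_cst; near=> h => /=.
rewrite dotvDr addrK dotvZr -[_ *: _]/(_ * _) mulKf//.
by near: h; exact: nbhs_dnbhs_neq.
Unshelve. all: by end_near. Qed.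

Lemma is_derive_dotv_sqr x v : is_derive x v (fun y => dotv y y) (2 * dotv x v).
Proof.
have -> : (fun y => dotv y y) = \sum_(i < n) (dotv (delta_mx 0 i) ^+ 2).
  apply/funext => y; rewrite fct_sumE; apply: eq_bigr => i _.
  by rewrite exprfctE/= dotvC dotv_delta expr2.
apply: is_derive_eq.
  apply: is_derive_sum => i; apply: is_deriveX; exact: is_derive_dotv.
rewrite mulr_sumr; apply: eq_bigr => i _ /=.
by rewrite expr1 !(dotvC (delta_mx _ _)) !dotv_delta mulrA.
Qed.

(** A minimum over the compact ball around [c] cannot lie on the bounding sphere, where [f] exceeds
    [f c]; so it is interior, hence local. *)
Lemma exists_local_min (f : 'rV[R]_n -> R) (c : 'rV[R]_n) (r : R) :
  continuous f -> 0 < r -> (forall z, `|z| = r -> f c < f (c + z)) ->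
  exists y, \forall z \near y, f y <= f z.
Proof.
move=> cf r0 H.
pose A := [set z : 'rV[R]_n | `|z - c| <= r].
have cA : compact A.
  apply: bounded_closed_compact.
    exists (r + `|c|); split; first exact: num_real.
    move=> M M1 z /= zr; rewrite -[z](subrK c) (le_trans (ler_normD _ _))//.
    by rewrite (le_trans _ (ltW M1))// lerD2r.
  have -> : A = (fun z => `|z - c|) @^-1` [set t | t <= r] by [].
  apply: closed_comp (@closed_le _ r) => z _.
  apply: (@continuous_comp _ _ _ (fun z => z - c) (@Num.norm _ _)).
    by apply: continuousB; [exact: cvg_id|exact: cst_continuous].
  exact: norm_continuous.
have A0 : A !=set0 by exists c; rewrite /A/= subrr normr0 ltW.
have cw : {within A, continuous f} by exact: continuous_subspaceT.
have [y yA ymin] := EVT_min_rV A0 cA cw.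
exists y.
have yr : `|y - c| < r.
  rewrite lt_neqAle; move: (yA); rewrite inE /A/= => ->; rewrite andbT.
  apply/eqP => /H; rewrite addrC subrK => fcy.
  have : c \in A by rewrite inE /A/= subrr normr0 ltW.
  by move=> /ymin; rewrite leNgt fcy.
apply/nbhs_normP; exists (r - `|y - c|); first by rewrite /= subr_gt0.
move=> z /=; rewrite distrC => zy; apply: ymin; rewrite inE /A /=.
by have := ler_normD (z - y) (y - c); rewrite addrA subrK; lra.
Qed.

Lemma near_line (P : set 'rV[R]_n) y v : (\forall z \near y, P z) ->
  \forall t \near (0 : R), P (y + t *: v).
Proof.
move=> /nbhs_normP[d /= d0 H]; apply/nbhs_normP.
have N0 : 0 < `|v| + 1 by rewrite ltr_wpDl.
exists (d / (`|v| + 1)); first by rewrite /= divr_gt0.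
move=> t /=; rewrite sub0r normrN ltr_pdivlMr// => td; apply: H => /=.
rewrite opprD addNKr normrN normrZ (le_lt_trans _ td)//.
by rewrite ler_wpM2l// lerDl.
Qed.

Lemma line_local_min_derive0 (f : 'rV[R]_n -> R) (F : 'rV[R]_n -> R) y v :
  (forall x, is_derive x v f (F x)) -> (\forall z \near y, f y <= f z) ->
  F y = 0.
Proof.
move=> df m; pose g t := f (y + t *: v).
have dg (t : R) : is_derive t (1 : R) g (F (y + t *: v)).
  exact: (is_derive_lineP y v f t _).1 (df _).
have dvg (t : R) : derivable g t 1 by case: (dg t).
have := dg 0; rewrite scale0r addr0; apply: local_min_derive0 => //.
by rewrite /g scale0r addr0; exact: (near_line v m).
Qed.

Lemma line_local_min_derive2_ge0 (f F : 'rV[R]_n -> R) (a : R) y v :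
  (forall x, is_derive x v f (F x)) -> is_derive y v F a ->
  (\forall z \near y, f y <= f z) -> 0 <= a.
Proof.
move=> df dF m.
apply: (@local_min_derive2_ge0 _ (fun t => f (y + t *: v)) (fun t => F (y + t *: v))).
- by move=> t; exact: (is_derive_lineP y v f t _).1 (df _).
- by apply: (is_derive_lineP y v F 0 _).1; rewrite scale0r addr0.
- by rewrite scale0r addr0; exact: (near_line v m).
Qed.

End RowVectors.

(** * Gradient, Hessian and convexity *)

Section Calculus.
Context {R : realType} {n : nat}.
Implicit Types (f u : 'rV[R]_n -> R) (x y v w : 'rV[R]_n).

Lemma class_CS k f : class_C k.+1 f -> class_C k f.
Proof.
elim: k f => [|k IH] f [cf H]; first by split.
split=> // i; have [df cpf] := H i; split => //; exact: IH.
Qed.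

Lemma class_C_partial k f i : class_C k.+1 f -> class_C k (partial i f).
Proof. by move=> [_ /(_ i)[]]. Qed.

Lemma class_C_continuous k f : class_C k f -> continuous f.
Proof. by case: k => [|k] []. Qed.

(** The direction [v] is built up one coordinate at a time with [is_derive_dirD]. *)
Lemma is_derive_grad f : class_C 1 f ->
  forall x v, is_derive x v f (dotv (grad f x) v).
Proof.
move=> C1 x v.
have dp i y : is_derive y (delta_mx 0 i) f (partial i f y).
  by have [_ /(_ i)[df _]] := C1; split => //; exact: df.
have cp i : continuous (partial i f).
  exact: class_C_continuous (class_C_partial i C1).
have H (r : seq 'I_n) y : is_derive y (\sum_(i <- r) v 0 i *: delta_mx 0 i) f
    (\sum_(i <- r) v 0 i * partial i f y).
  elim: r y => [|i r IH] y; first by rewrite !big_nil; exact: is_derive0.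
  (* After the swap, the derivative required to be continuous is that of the single new
     coordinate. *)
  rewrite !big_cons ![_ + \sum_(_ <- r) _]addrC.
  apply: (@is_derive_dirD _ _ _ _ _ (fun z => \sum_(j <- r) v 0 j * partial j f z)
     (fun z => v 0 i * partial i f z)) => // z.
    exact: cvgMl_tmp (cp i z).
  exact: is_derive_dirZ.
rewrite [v in is_derive _ v](row_sum_delta v).
have -> : dotv (grad f x) v = \sum_i v 0 i * partial i f x.
  by apply: eq_bigr => i _; rewrite mxE mulrC.
exact: H.
Qed.

Lemma hessian_sym u x : class_C 2 u -> (hessian u x)^T = hessian u x.
Proof.
move=> C2; apply/matrixP => i j; rewrite !mxE.
have d k : forall y, is_derive y (delta_mx 0 k) u (partial k u y).
  by move=> y; have [_ /(_ k)[df _]] := C2; split => //; exact: df.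
have dd k l : forall y, is_derive y (delta_mx 0 k) (partial l u)
    (partial k (partial l u) y).
  move=> y; have [_ /(_ k)[df _]] := class_C_partial l C2.
  by split => //; exact: df.
have c k l : continuous (partial k (partial l u)).
  exact: class_C_continuous (class_C_partial k (class_C_partial l C2)).
exact: (mixed_derive_eq (d j) (d i) (dd i j) (dd j i) (c i j) (c j i)).
Qed.

Lemma is_derive_dotv_grad u : class_C 2 u -> forall x v w,
  is_derive x w (fun y => dotv (grad u y) v) (dotv (w *m hessian u x) v).
Proof.
move=> C2 x v w.
have -> : (fun y => dotv (grad u y) v) =
    \sum_(i < n) (v 0 i \*: (partial i u)).
  apply/funext => y; rewrite fct_sumE; apply: eq_bigr => i _.
  by rewrite mxE mulrC.
apply: is_derive_eq.
  apply: is_derive_sum => i; apply: is_deriveZ.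
  exact: is_derive_grad (class_C_partial i C2) _ _.
(* Differentiating [partial i u] along [w] pairs [w] with row [i] of the Hessian, whereas
   [w *m hessian u x] uses column [i]. *)
rewrite -hessian_sym//; apply: eq_bigr => i _ /=.
rewrite mulrC mxE; congr (_ * _); apply: eq_bigr => j _.
by rewrite !mxE mulrC.
Qed.

(** By convexity the difference quotients of step [h] in []0, 1]] towards [y] are at most
    [u y - u x]; their right limit at 0 inherits the bound. *)
Lemma convex_grad_le u x y : class_C 1 u -> convex_function [set: 'rV[R]_n] u ->
  u x + dotv (grad u x) (y - x) <= u y.
Proof.
move=> C1 cu; rewrite -lerBrDl.
have /is_derive_cvgP H := is_derive_grad C1 x (y - x).
have {}H := cvg_dnbhs_at_right H.
apply: (cvgr_to_le H); near=> h.
have h0 : 0 < h by near: h; exact: nbhs_right_gt.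
have h1 : h <= 1 by near: h; exact: nbhs_right_le.
rewrite /= -[_ *: _]/(_ * _) ler_pdivrMl//.
have := cu (Itv01 (ltW h0) h1) y x; rewrite !inE => /(_ I I).
move=> H1.
have -> : h *: (y - x) + x = h *: y + (1 - h) *: x.
  by rewrite scalerBr scalerBl scale1r addrA addrAC.
have : u (h *: y + (1 - h) *: x) <= h * u y + (1 - h) * u x := H1.
lra.
Unshelve. all: by end_near. Qed.

(** Subtracting the linear form with slope [grad u x] leaves a function minimal at [x], to which the
    second derivative test along [v] applies. *)
Lemma convex_hessian_ge0 u x v : class_C 2 u ->
  convex_function [set: 'rV[R]_n] u -> 0 <= dotv (v *m hessian u x) v.
Proof.
move=> C2 cu; pose p := grad u x.
apply: (@line_local_min_derive2_ge0 _ _ (u \- dotv p)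
    (fun z => dotv (grad u z) v - dotv p v) _ x v).
- move=> z; apply: is_deriveB (is_derive_dotv p z v).
  exact: is_derive_grad (class_CS C2) z v.
- rewrite -[X in is_derive _ _ _ X]subr0; apply: is_deriveB.
  exact: is_derive_dotv_grad.
- apply/nbhs_normP; exists 1 => //= z _.
  by have := convex_grad_le x z (class_CS C2) cu; rewrite dotvBr -/p; lra.
Qed.

End Calculus.

(** * The image of the gradient and a direction of constant slope *)

Section GradientImage.
Context {R : realType} {n : nat}.
Implicit Types (u : 'rV[R]_n -> R) (x y z v w : 'rV[R]_n).

(** Greedy construction: fewer than [n] independent values of [g] admit a nonzero common orthogonal
    vector [v], and if the first alternative fails, some value of [g] is not orthogonal to [v] and
    extends the family. *)
Lemma orthogonal_or_basis {T : Type} (t0 : T) (g : T -> 'rV[R]_n) :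
  (exists2 v, v != 0 & forall t, dotv (g t) v = 0) \/
  exists t : 'I_n -> T, (\matrix_i g (t i)) \in unitmx.
Proof.
have [|no_v] := pselect (exists2 v, v != 0 & forall t, dotv (g t) v = 0).
  by left.
right.
have H k : (k <= n)%N -> exists t : 'I_k -> T, row_free (\matrix_i g (t i)).
  elim: k => [_|k IH kn].
    by exists (fun=> t0); rewrite -row_leq_rank.
  have [t ft] := IH (ltnW kn); set A := \matrix_i g (t i) in ft.
  have /rowV0Pn[v vA v0] : kermx A^T != 0.
    rewrite -mxrank_eq0 mxrank_ker mxrank_tr subn_eq0 -ltnNge.
    by move: ft; rewrite /row_free => /eqP ->.
  move/sub_kermxP in vA.
  have [s sv] : exists s, dotv (g s) v != 0.
    apply: contrapT => H; apply: no_v; exists v => // s.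
    by apply/eqP/negPn/negP => gv; apply: H; exists s.
  exists (fun i : 'I_(1 + k) => if fintype.split i is inr j then t j else s).
  have -> : (\matrix_(i < 1 + k) g (if fintype.split i is inr j then t j else s)) =
      col_mx (g s) A.
    apply/row_matrixP => i; rewrite rowK; case: (fintype.splitP i) => j ij.
      rewrite (_ : i = lshift k j); last exact: val_inj.
      by rewrite rowKu (ord1 j) row_id.
    rewrite (_ : i = rshift 1 j); last exact: val_inj.
    by rewrite rowKd rowK.
  apply: inj_row_free => w wE.
  pose a := @lsubmx _ 1 1 k w; pose b := @rsubmx _ 1 1 k w.
  have E : a *m g s + b *m A = 0 by rewrite -mul_row_col hsubmxK.
  have gv : g s *m v^T = (dotv (g s) v)%:M.
    apply/matrixP => i j; rewrite !mxE !ord1 eqxx mulr1n.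
    by apply: eq_bigr => l _; rewrite mxE.
  (* Pairing the relation with [v] kills the old rows and leaves [a] times the nonzero number
     [dotv (g s) v]. *)
  have a0 : a = 0.
    have : (a *m g s + b *m A) *m v^T = 0 by rewrite E mul0mx.
    rewrite mulmxDl -!mulmxA gv -[A *m _]trmxK trmx_mul trmxK vA trmx0 mulmx0.
    rewrite addr0 mul_mx_scalar => /eqP.
    by rewrite scaler_eq0 (negbTE sv)/= => /eqP.
  move: E; rewrite a0 mul0mx add0r => bA.
  have b0 : b = 0 by apply: (row_free_inj ft); rewrite bA mul0mx.
  by rewrite -[w](@hsubmxK _ 1 1 k) -/a -/b a0 b0 row_mx0.
by have [t ft] := H n (leqnn n); exists t; rewrite -row_free_unit.
Qed.

Lemma dotv_suml (I : finType) (d : I -> 'rV[R]_n) x :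
  dotv (\sum_i d i) x = \sum_i dotv (d i) x.
Proof.
elim/big_ind2 : _ => // [|? a ? b <- <-]; last by rewrite dotvDl.
by rewrite -[X in dotv X](scale0r 0) dotvZl mul0r.
Qed.

(** The inverse of [B] recovers the coordinates of [x] from its products with the rows; the 1 in the
    constant ensures positivity. *)
Lemma norm_le_invmx (B : 'M[R]_n) : B \in unitmx ->
  exists2 K : R, 0 < K & forall x, `|x| <= K * \sum_i `|dotv (row i B) x|.
Proof.
move=> uB; exists (1 + \sum_j \sum_i `|invmx B j i|).
  by rewrite ltr_wpDr// sumr_ge0// => j _; exact: sumr_ge0.
move=> x; set S := \sum_i `|dotv _ _|.
have S0 : 0 <= S by exact: sumr_ge0.
have xE j : x 0 j = \sum_i invmx B j i * dotv (row i B) x.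
  have -> : x 0 j = (invmx B *m (B *m x^T)) j 0 by rewrite mulKmx// mxE.
  rewrite mxE; apply: eq_bigr => i _; congr (_ * _); rewrite mxE.
  by apply: eq_bigr => k _; rewrite !mxE.
rewrite (le_trans (norm_le_sum_coord x))// mulrDl mul1r.
apply: (@le_trans _ _ ((\sum_j \sum_i `|invmx B j i|) * S)); last first.
  by rewrite lerDr.
rewrite mulr_suml; apply: ler_sum => j _; rewrite xE.
rewrite (le_trans (ler_norm_sum _ _ _))// mulr_suml; apply: ler_sum => i _.
by rewrite normrM ler_wpM2l// /S (bigD1 i)//= lerDl sumr_ge0.
Qed.

(* The slopes [grad u (t i)] and [grad u 0] span a simplex; for [q] in its
   interior, [u] grows linearly faster than the linear form [dotv q]. *)
Lemma gradient_basis_coercive u (t : 'I_n -> 'rV[R]_n) :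
  class_C 1 u -> convex_function [set: 'rV[R]_n] u ->
  (\matrix_i (grad u (t i) - grad u 0)) \in unitmx ->
  exists q e C, 0 < e /\ forall x, dotv q x + e * `|x| - C <= u x.
Proof.
move=> C1 cu /norm_le_invmx[K K0 HK].
pose d i := grad u (t i) - grad u 0.
pose c i := dotv (grad u (t i)) (t i) - u (t i).
pose C := `|u 0| + \sum_i `|c i|.
(* Each [grad u (t i)] gets weight [N^-1] in [q], which leaves [grad u 0] the positive weight
   [1 - n / N]. *)
pose N : R := 2 * n.+1%:R.
have N0 : 0 < N by rewrite mulr_gt0.
exists (grad u 0 + N^-1 *: \sum_i d i), (N * K)^-1, C.
split; first by rewrite invr_gt0 mulr_gt0.
move=> x; set w := u x - dotv (grad u 0) x + C.
have cC i : `|c i| <= \sum_i `|c i| by rewrite (bigD1 i)//= lerDl sumr_ge0.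
have w0 : 0 <= w.
  have := convex_grad_le 0 x C1 cu; rewrite subr0 /w /C.
  have : 0 <= \sum_i `|c i| by exact: sumr_ge0.
  have := ler_norm (- u 0); rewrite normrN; lra.
(* The tangent inequality at [t i] gives [dotv (d i) x <= w], and the left side is either 0 or twice
   [dotv (d i) x]. Summing over [i] brings in the absolute values that control [|x|]. *)
have wd i : dotv (d i) x + `|dotv (d i) x| <= 2 * w.
  suff : dotv (d i) x <= w by case: ger0P => _; lra.
  have := convex_grad_le (t i) x C1 cu; rewrite dotvBr /d dotvBl /w /C.
  have := cC i.
  have : dotv (grad u (t i)) (t i) - u (t i) <= `|c i| := ler_norm (c i).
  have := normr_ge0 (u 0); lra.
have : \sum_i (dotv (d i) x + `|dotv (d i) x|) <= N * w.
  apply: (@le_trans _ _ (\sum_(i < n) 2 * w)); first exact: ler_sum.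
  rewrite sumr_const card_ord -[_ *+ n]mulr_natr mulrAC ler_wpM2r// ler_wpM2l//.
  by rewrite ler_nat.
rewrite big_split/= dotvDl dotvZl dotv_suml.
set S := \sum_i dotv _ _; set T := \sum_i `|_| => STw.
have xT : K^-1 * `|x| <= T.
  rewrite ler_pdivrMl// (le_trans (HK x))// (ler_wpM2l (ltW K0))//.
  by apply: ler_sum => i _; rewrite rowK.
have : N^-1 * (S + K^-1 * `|x|) <= w.
  by rewrite ler_pdivrMl// (le_trans _ STw)// lerD2l.
rewrite (invfM N K) mulrDr mulrA /w; lra.
Qed.

Lemma flat_direction u : class_C 2 u -> convex_function [set: 'rV[R]_n] u ->
  (forall x, tildeKM u x = 0) ->
  exists2 v, v != 0 & forall x, dotv (grad u x) v = dotv (grad u 0) v.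
Proof.
move=> C2 cu K0; have C1 := class_CS C2.
have [[v v0 vg]|[t ut]] :=
    orthogonal_or_basis (0 : 'rV[R]_n) (fun x => grad u x - grad u 0).
  by exists v => // x; apply/eqP; rewrite -subr_eq0 -dotvBl vg.
have [q [e [C [e0 uq]]]] := gradient_basis_coercive C1 cu ut.
exfalso.
(* On the sphere of radius [r], coercivity makes [u z - dotv q z] at least [u 0 + 1], while the
   choice of [m] keeps the subtracted quadratic term below 1. So [f] exceeds [f 0] there. *)
pose r := (`|u 0| + `|C| + 1) / e.
have r0 : 0 < r by rewrite divr_gt0// ltr_wpDl// addr_ge0.
pose m : R := n%:R * r ^+ 2 + 1.
have m0 : 0 < m by rewrite ltr_wpDl// mulr_ge0// sqr_ge0.
pose f := u \- dotv q \- (m^-1 \*: (fun z : 'rV[R]_n => dotv z z)).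
have df x v : is_derive x v f
    (dotv (grad u x) v - dotv q v - m^-1 * (2 * dotv x v)).
  apply: is_deriveB; last exact: is_deriveZ (is_derive_dotv_sqr x v).
  exact: is_deriveB (is_derive_grad C1 x v) (is_derive_dotv q x v).
have cf : continuous f.
  have cu0 : continuous u := class_C_continuous C1.
  have cq : continuous (dotv q) := @dotv_continuous _ _ q.
  have cs : continuous (fun z : 'rV[R]_n => dotv z z) := @dotv_sqr_continuous _ _.
  by move=> x; exact: cvgB (cvgB (cu0 x) (cq x)) (cvgZl_tmp (cs x)).
have [|y ymin] := exists_local_min (c := 0) cf r0.
  move=> z zr; rewrite add0r /f /=.
  have n0 : 0 <= dotv (0 : 'rV[R]_n) 0 by exact: dotv_ge0.
  have -> : dotv q 0 = 0 by rewrite -(scale0r 0) dotvZr mul0r.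
  have : m^-1 * dotv z z < 1.
    rewrite ltr_pdivrMl// mulr1 (le_lt_trans (dotv_le_norm_sqr z))// zr.
    by rewrite /m ltrDl.
  have : 0 <= m^-1 * dotv (0 : 'rV[R]_n) 0 by rewrite mulr_ge0// invr_ge0 ltW.
  have := uq z; rewrite zr mulrC mulrVK ?unitfE ?gt_eqF//.
  have := ler_norm C; have := ler_norm (u 0); rewrite -![_ *: _]/(_ * _); lra.
(* Along a kernel vector of the Hessian only the quadratic term contributes to the second derivative
   of [f], which is then negative at the minimum. *)
have /det0P[v v0 vH] : \det (hessian u y) == 0 by apply/eqP; exact: K0.
have dF : is_derive y v (fun x => dotv (grad u x) v - dotv q v - m^-1 * (2 * dotv x v))
    (- (m^-1 * (2 * dotv v v))).
  have -> : (fun x => dotv (grad u x) v - dotv q v - m^-1 * (2 * dotv x v)) =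
      (fun x => dotv (grad u x) v) \- cst (dotv q v) \- ((m^-1 * 2) \*: dotv v).
    by apply/funext => x /=; rewrite (dotvC v) -[_ *: _]/(_ * _) mulrA.
  have -> : - (m^-1 * (2 * dotv v v)) =
      dotv (v *m hessian u y) v - 0 - (m^-1 * 2) *: dotv v v.
    by rewrite vH -(scale0r 0) dotvZl mul0r subr0 sub0r -[_ *: _]/(_ * _) mulrA.
  apply: is_deriveB; last exact: is_deriveZ (is_derive_dotv v y v).
  by apply: is_deriveB; exact: is_derive_dotv_grad.
have := line_local_min_derive2_ge0 (df^~ v) dF ymin.
rewrite oppr_ge0 pmulr_rle0 ?invr_gt0// pmulr_rle0// => vv.
have /eqP : dotv v v = 0 by apply/eqP; rewrite eq_le vv dotv_ge0.
by rewrite dotv_eq0 (negbTE v0).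
Qed.

End GradientImage.

(** * Invariance of [tildeHM] along a direction of constant slope *)

Section Translation.
Context {R : realType} {n : nat}.
Implicit Types (f u : 'rV[R]_n -> R) (x y z v w a : 'rV[R]_n).

Lemma partial_translate f a (k : R) i : (forall y, f (y + a) = f y + k) ->
  forall x, partial i f (x + a) = partial i f x.
Proof.
move=> fa x; rewrite /partial /derive.
suff -> : (fun h : R => h^-1 *: ((f \o shift (x + a)) (h *: delta_mx 0 i)
      - f (x + a))) =
    (fun h => h^-1 *: ((f \o shift x) (h *: delta_mx 0 i) - f x)) by [].
apply/funext => h /=; congr (_ *: _).
by rewrite addrA !fa opprD addrACA subrr addr0.
Qed.

Lemma tildeHM_translate u a (k : R) : (forall y, u (y + a) = u y + k) ->
  forall x, tildeHM u (x + a) = tildeHM u x.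
Proof.
move=> ua x.
have p1 i : forall y, partial i u (y + a) = partial i u y.
  exact: partial_translate ua.
have p2 i j : partial j (partial i u) (x + a) = partial j (partial i u) x.
  by apply: (@partial_translate (partial i u) a 0 j) => y; rewrite p1 addr0.
have g : grad u (x + a) = grad u x by apply/rowP => i; rewrite !mxE p1.
rewrite /tildeHM /wM g; have -> : laplacian u (x + a) = laplacian u x.
  by apply: eq_bigr => i _; rewrite p2.
congr +%R; apply: eq_bigr => i _; apply: eq_bigr => j _.
by rewrite !p1 p2.
Qed.

Lemma exists_line_enorm_gt x v (M : R) : v != 0 ->
  exists t, M < enorm (x + t *: v).
Proof.
move=> /rV0Pn[i vi]; exists ((`|M| + 1 - x 0 i) / v 0 i).
set z := x + _.
have zi : z 0 i = `|M| + 1 by rewrite !mxE mulrVK ?unitfE// addrC subrK.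
apply: (@lt_le_trans _ _ (z 0 i)).
  by rewrite zi (le_lt_trans (ler_norm M))// ltrDl.
have z0 : 0 <= z 0 i by rewrite zi addr_ge0.
rewrite -(ger0_norm z0) -sqrtr_sqr /enorm ler_wsqrtr//.
rewrite /dotv (bigD1 i)//= -expr2 lerDl.
by apply: sumr_ge0 => j _; rewrite -expr2 sqr_ge0.
Qed.

(** Translation along [v] changes [u] by a constant, so the value of [tildeHM] at [x] recurs
    arbitrarily far out. Taking its absolute value as tolerance in the limit makes it smaller than
    itself unless it vanishes. *)
Lemma tildeHM_eq0_of_flat u v : class_C 1 u -> v != 0 ->
  (forall x, dotv (grad u x) v = dotv (grad u 0) v) ->
  tildeHM u x @[x --> at_infty] --> (0 : R) -> forall x, tildeHM u x = 0.
Proof.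
move=> C1 v0 vg /cvgrPdist_lt H x; apply: contrapT => /eqP Hx.
have [] := H `|tildeHM u x|; first by rewrite normr_gt0.
move=> M _ HM; have [t /HM] := exists_line_enorm_gt x M v0.
rewrite /= sub0r normrN (@tildeHM_translate _ _ (t * dotv (grad u 0) v)) ?ltxx//.
move=> y; have [s _ E] := line_MVT y t (fun z => is_derive_grad C1 z v).
by rewrite -(vg (y + s *: v)) -E [RHS]addrC subrK.
Qed.

End Translation.

(** * Constancy of the gradient, along rays and then globally *)

Section GradientRays.
Context {R : realType} {n : nat}.
Implicit Types (u : 'rV[R]_n -> R) (p x y z v w : 'rV[R]_n) (A : 'M[R]_n).

Lemma psd_isotropic_ker A p : A^T = A -> (forall v, 0 <= dotv (v *m A) v) ->
  dotv (p *m A) p = 0 -> p *m A = 0.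
Proof.
move=> sA A0 pA; set w := p *m A.
set b := dotv w w; set a := dotv (w *m A) w.
have pw : dotv (w *m A) p = b by rewrite dotv_mulmx sA.
have a0 : 0 <= a by exact: A0.
have b0 : 0 <= b by exact: dotv_ge0.
(* The form at this vector equals [- b ^+ 2 * (a + 2)], so its nonnegativity forces [b = 0]. *)
have := A0 ((1 + a) *: p - b *: w).
rewrite mulmxBl -!scalemxAl !(dotvBl, dotvBr, dotvZl, dotvZr) -/w pw -/a.
rewrite pA -/b => H.
have /eqP : b = 0 by nra.
by rewrite dotv_eq0 => /eqP.
Qed.

Lemma grad_hessian_eq0 u x : class_C 2 u ->
  convex_function [set: 'rV[R]_n] u -> ~ timelike u x -> tildeHM u x = 0 ->
  grad u x *m hessian u x = 0.
Proof.
move=> C2 cu tl H.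
have psd v : 0 <= dotv (v *m hessian u x) v by exact: convex_hessian_ge0.
apply: psd_isotropic_ker => //; first exact: hessian_sym.
apply/eqP; rewrite eq_le psd andbT.
have w0 : 0 <= wM u x.
  rewrite /wM subr_ge0 expr_le1 ?sqrtr_ge0//.
  by rewrite leNgt; apply/negP.
have l0 : 0 <= laplacian u x.
  apply: sumr_ge0 => i _; have := psd (delta_mx 0 i).
  by rewrite dotv_delta -rowE !mxE.
have := mulr_ge0 w0 l0.
suff -> : dotv (grad u x *m hessian u x) (grad u x) =
    \sum_i \sum_j partial i u x * partial j u x * partial j (partial i u) x.
  by move: H; rewrite /tildeHM; lra.
rewrite exchange_big; apply: eq_bigr => j _; rewrite !mxE mulr_suml.
by apply: eq_bigr => i _; rewrite !mxE mulrAC.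
Qed.

Lemma is_derive_dist_grad u p z w : class_C 2 u ->
  is_derive z w (fun y => dotv (grad u y - p) (grad u y - p))
    (2 * dotv (w *m hessian u z) (grad u z - p)).
Proof.
move=> C2.
have -> : (fun y => dotv (grad u y - p) (grad u y - p)) =
    \sum_(i < n) (partial i u \- cst (p 0 i)) ^+ 2.
  apply/funext => y; rewrite fct_sumE; apply: eq_bigr => i _.
  by rewrite exprfctE/= expr2 !mxE.
apply: is_derive_eq.
  apply: is_derive_sum => i; apply: is_deriveX; apply: is_deriveB.
  exact: is_derive_grad (class_C_partial i C2) _ _.
rewrite -hessian_sym// mulr_sumr; apply: eq_bigr => i _ /=.
rewrite expr1 subr0 -[_ *: _]/(_ * _) -mulrA; congr (_ * _).
rewrite mulrC !mxE; congr (_ * _); apply: eq_bigr => j _.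
by rewrite !mxE mulrC.
Qed.

Lemma grad_forward_ray u x (t : R) : class_C 2 u ->
  convex_function [set: 'rV[R]_n] u ->
  (forall z, grad u z *m hessian u z = 0) -> 0 <= t ->
  grad u (x + t *: grad u x) = grad u x.
Proof.
move=> C2 cu H t0; set p := grad u x.
have [s _] := line_MVT x t (fun z => is_derive_dist_grad p z p C2).
rewrite -/p subrr.
have -> : dotv (0 : 'rV[R]_n) 0 = 0 by apply/eqP; rewrite dotv_eq0.
rewrite subr0; set z := x + s *: p; set y := x + t *: p => E.
(* Since [grad u z] is in the kernel of the Hessian at [z], [p] may be replaced by
   [- (grad u z - p)], which gives minus a value of a nonnegative form. *)
have Hz : dotv (p *m hessian u z) (grad u z - p) <= 0.
  have := convex_hessian_ge0 z (grad u z - p) C2 cu.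
  rewrite mulmxBl H sub0r -[X in dotv X]scaleN1r dotvZl; lra.
apply/eqP; rewrite -subr_eq0 -dotv_eq0 eq_le dotv_ge0 andbT E.
by rewrite mulr_ge0_le0// mulr_ge0_le0.
Qed.

(* [y] is the minimiser of [u z + |z - x|^2 / (2 tau)]; the square is expanded
   in the proof and its constant term dropped. *)
Lemma exists_backward u x (tau : R) : class_C 1 u ->
  convex_function [set: 'rV[R]_n] u -> 0 < tau ->
  exists y, x = y + tau *: grad u y.
Proof.
move=> C1 cu tau0.
pose f := u \+ ((2 * tau)^-1 \*: (fun z : 'rV[R]_n => dotv z z))
            \- (tau^-1 \*: dotv x).
have df z v : is_derive z v f
    (dotv (grad u z) v + (2 * tau)^-1 * (2 * dotv z v) - tau^-1 * dotv x v).
  apply: is_deriveB; last exact: is_deriveZ (is_derive_dotv x z v).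
  apply: is_deriveD; first exact: is_derive_grad.
  exact: is_deriveZ (is_derive_dotv_sqr z v).
have cf : continuous f.
  have cu0 : continuous u := class_C_continuous C1.
  have cq : continuous (dotv x) := @dotv_continuous _ _ x.
  have cs : continuous (fun z : 'rV[R]_n => dotv z z) := @dotv_sqr_continuous _ _.
  move=> z; exact: cvgB (cvgD (cu0 z) (cvgZl_tmp (cs z))) (cvgZl_tmp (cq z)).
pose P := \sum_i `|grad u x 0 i|.
have P0 : 0 <= P by exact: sumr_ge0.
(* On the sphere of radius [r] the quadratic term is at least [r * (P + 1)], which beats the loss of
   at most [P * r] in the tangent inequality at [x]. *)
pose r := 2 * tau * (P + 1).
have r0 : 0 < r by rewrite !mulr_gt0// ltr_wpDl.
have [|y ymin] := exists_local_min (c := x) cf r0.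
  move=> z zr; rewrite /f /= -![_ *: _]/(_ * _).
  rewrite !(dotvDl, dotvDr) (dotvC z x).
  have := convex_grad_le x (x + z) C1 cu; rewrite addrAC subrr add0r.
  have : - (P * r) <= dotv (grad u x) z.
    have := ler_norm_dotv (grad u x) z; rewrite zr -/P.
    by rewrite ler_norml => /andP[].
  have : r * (P + 1) <= (2 * tau)^-1 * dotv z z.
    rewrite ler_pdivlMl ?mulr_gt0// mulrCA -/r -expr2 -zr.
    exact: norm_sqr_le_dotv.
  have -> : tau^-1 * (dotv x x + dotv x z) =
     tau^-1 * dotv x x + 2 * ((2 * tau)^-1 * dotv x z).
    by field; rewrite gt_eqF.
  rewrite !mulrDr mulr1; lra.
exists y; set g := grad u y.
have crit v : dotv (g + tau^-1 *: (y - x)) v = 0.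
  have := line_local_min_derive0 (df^~ v) ymin.
  rewrite dotvDl dotvZl dotvBl => <-; field.
  by rewrite gt_eqF.
have /eqP := crit (g + tau^-1 *: (y - x)).
rewrite dotv_eq0 addr_eq0 => /eqP ->.
by rewrite scalerN scalerA divff ?gt_eqF// scale1r opprB addrC subrK.
Qed.

Lemma dotv_grad_ge u x z : class_C 2 u ->
  convex_function [set: 'rV[R]_n] u ->
  (forall y, grad u y *m hessian u y = 0) ->
  dotv (grad u x) (grad u x) <= dotv (grad u z) (grad u x).
Proof.
move=> C2 cu H; have C1 := class_CS C2.
set p := grad u x; set q := grad u z.
rewrite leNgt; apply/negP; rewrite -subr_gt0; set D := _ - _ => D0.
pose M := u x - u z - dotv q (x - z).
(* The gradient inequalities from [z] to [y] and from [y] to [x] add up to [tau * D <= M], with [M]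
   independent of [tau]; this one value of [tau] replaces the limit and yields [|M| + 1 <= M]. *)
pose tau := (`|M| + 1) / D.
have tau0 : 0 < tau by rewrite divr_gt0// ltr_wpDl.
have [y xy] := exists_backward x C1 cu tau0.
have yp : grad u y = p by rewrite /p xy grad_forward_ray// ltW.
have xyE : x - y = tau *: p by rewrite {1}xy yp addrAC subrr add0r.
have := convex_grad_le y x C1 cu; have := convex_grad_le z y C1 cu.
rewrite yp -/q xyE dotvZr.
have -> : y - z = (x - z) - tau *: p.
  by rewrite -xyE opprB [RHS]addrC addrA subrK.
rewrite dotvBr dotvZr => H1 H2.
have : tau * D <= M by rewrite /D /M mulrBr; lra.
by rewrite /tau mulrVK ?unitfE ?gt_eqF//; have := ler_norm M; lra.
Qed.

Lemma grad_constant u : class_C 2 u -> convex_function [set: 'rV[R]_n] u ->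
  (forall y, grad u y *m hessian u y = 0) ->
  forall x z, grad u x = grad u z.
Proof.
move=> C2 cu H x z; apply/eqP; rewrite -subr_eq0 -dotv_eq0 eq_le dotv_ge0 andbT.
have := dotv_grad_ge x z C2 cu H; have := dotv_grad_ge z x C2 cu H.
rewrite !(dotvBl, dotvBr) (dotvC (grad u z) (grad u x)); lra.
Qed.

(** The gradient inequalities from 0 to [x] and from [x] to 0 have the same slope [p], so together
    they give equality and [u] is affine. *)
Lemma graph_hyperplane u p : class_C 1 u ->
  convex_function [set: 'rV[R]_n] u -> (forall x, grad u x = p) ->
  hyperplane (graph_of u).
Proof.
move=> C1 cu gp; exists p, (-1), (- u 0); split.
  by right; rewrite oppr_eq0 oner_eq0.
have uE x : u x = u 0 + dotv p x.
  have := convex_grad_le 0 x C1 cu; have := convex_grad_le x 0 C1 cu.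
  rewrite !gp sub0r subr0 dotvNr; lra.
by apply/seteqP; split => -[x s] /=; rewrite /graph_of /= (uE x); lra.
Qed.

End GradientRays.

Unset Implicit Arguments.

Theorem theorem1p6 (R : realType) (n : nat) (u : 'rV[R]_n -> R)
  (u_C4 : class_C 4 u)
  (u_convex : convex_function [set: 'rV[R]_n] u)
  (K0 : forall x : 'rV[R]_n, tildeKM u x = 0)
  (no_timelike : forall x : 'rV[R]_n, ~ timelike u x)
  (H_lim : tildeHM u x @[x --> at_infty] --> (0 : R)) :
  hyperplane (graph_of u).
Proof.
have C2 : class_C 2 u by do 2 apply: class_CS.
have C1 : class_C 1 u by exact: class_CS.
have [v v0 vg] := flat_direction C2 u_convex K0.
have H0 := tildeHM_eq0_of_flat C1 v0 vg H_lim.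
apply: (graph_hyperplane C1 u_convex (p := grad u 0)) => x.
apply: grad_constant => // y; exact: grad_hessian_eq0.
Qed.
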